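(* Let $t\ge1$ be an integer and consider the grid peeling of the grid parabola $P_t$, i.e., the sequence $U_0,U_1,\dots$ with $U_0$ the set of points of $\Lambda_t$ lying on or above $P_t$. If $t$ is odd, then $U_t=U_0+(0,1)$. If $t$ is even, then $U_{t+1}=U_0+(0,1)$. (That is, $P_t$ reappears, translated one unit upward, after $t$ peeling steps when $t$ is odd and after $t+1$ steps when $t$ is even.)
   Context: Fix an integer $t\ge1$. Let $S_t$ be the set of rational numbers $s$ which, written in lowest terms as $s=a/b$ with $a\in\mathbb Z$ and $b$ a positive integer, satisfy $b\le t$. For $s=a/b\in S_t$ let $v_s=\lfloor t/b\rfloor\,(b,a)$ (the longest integer multiple $q(b,a)$, $q\in\mathbb Z$, with $0<qb\le t$), and let $V_t=\{v_s: s\in S_t\}$. The grid parabola $P_t$ is the infinite convex polygonal chain obtained by concatenating the vectors of $V_t$ in order of increasing slope, positioned so that the edge given by the vector $(t,0)$ (slope $0$) goes from $(-t/2,0)$ to $(t/2,0)$. Its vertices lie in the lattice $\Lambda_t=(\tfrac t2+\mathbb Z)\times\mathbb Z$, called the grid. Peeling: one step applied to a set $U$ of points removes from $U$ all vertices (extreme points) of $\mathrm{conv}(U)$; the grid peeling of $P_t$ is $U_0=$ the points of $\Lambda_t$ on or above $P_t$ and $U_{k+1}=U_k\setminus\{\text{vertices of }\mathrm{conv}(U_k)\}$. *)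

(* Defs.v *)
From HB Require Import structures.
From mathcomp Require Import all_boot all_order all_algebra.
Set Implicit Arguments. Unset Strict Implicit. Unset Printing Implicit Defensive.
Import Order.TTheory GRing.Theory Num.Theory.
Local Open Scope ring_scope.

(* Points of the plane; all relevant points have rational coordinates. *)
Definition pt := (rat * rat)%type.

Definition inS (t : nat) (s : rat) : bool := denq s <= t%:Z.

Definition den (s : rat) : nat := absz (denq s).

Definition vx (t : nat) (s : rat) : rat := ((t %/ den s) * den s)%N%:R.
Definition vy (t : nat) (s : rat) : rat := ((t %/ den s)%:Z * numq s)%:~R.

(* A finite list (without duplicates) containing every rational with
   denominator <= t and absolute value <= M. *)
Definition Sbox (t M : nat) : seq rat :=
  undup [seq (a%:~R / b%:R : rat) | b <- iota 1 t,
           a <- [seq (k%:Z - (M * t)%N%:Z) | k <- iota 0 (2 * M * t).+1]].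

Definition bnd (s : rat) : nat := (absz (numq s)).+1.

(* Starting point of the edge v_s of the chain P_t: the edges are concatenated
   in order of increasing slope, the slope-0 edge going from (-t/2,0) to (t/2,0). *)
Definition startx (t : nat) (s : rat) : rat :=
  if 0 <= s then
    - (t%:R / 2) + \sum_(s' <- Sbox t (bnd s) | inS t s' && (0 <= s') && (s' < s)) vx t s'
  else
    - (t%:R / 2) - \sum_(s' <- Sbox t (bnd s) | inS t s' && (s <= s') && (s' < 0)) vx t s'.

Definition starty (t : nat) (s : rat) : rat :=
  if 0 <= s then
    \sum_(s' <- Sbox t (bnd s) | inS t s' && (0 <= s') && (s' < s)) vy t s'
  else
    - \sum_(s' <- Sbox t (bnd s) | inS t s' && (s <= s') && (s' < 0)) vy t s'.

Definition onP (t : nat) (p : pt) : Prop :=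
  exists s, inS t s /\ exists l : rat, 0 <= l <= 1 /\
    p = (startx t s + l * vx t s, starty t s + l * vy t s).

Definition inGrid (t : nat) (p : pt) : Prop :=
  exists i j : int, p.1 = t%:R / 2 + i%:~R /\ p.2 = j%:~R.

Definition U0 (t : nat) (p : pt) : Prop :=
  inGrid t p /\ exists y, onP t (p.1, y) /\ y <= p.2.

Definition conv (U : pt -> Prop) (p : pt) : Prop :=
  exists (n : nat) (w : 'I_n -> rat) (q : 'I_n -> pt),
    (forall i, U (q i)) /\ (forall i, 0 <= w i) /\ \sum_(i < n) w i = 1 /\
    p.1 = \sum_(i < n) w i * (q i).1 /\ p.2 = \sum_(i < n) w i * (q i).2.

Definition extreme (C : pt -> Prop) (p : pt) : Prop :=
  C p /\ forall (a b : pt) (l : rat), C a -> C b -> 0 < l < 1 ->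
    p = (l * a.1 + (1 - l) * b.1, l * a.2 + (1 - l) * b.2) -> a = b.

Definition peel (U : pt -> Prop) (p : pt) : Prop :=
  U p /\ ~ extreme (conv U) p.

Definition Uk (t k : nat) : pt -> Prop := iter k peel (U0 t).

(* Main.v *)
Require Import Defs.
From mathcomp Require Import all_boot all_order all_algebra.
From mathcomp Require Import zify ring lra.
Import Order.TTheory GRing.Theory Num.Theory.
Set Implicit Arguments. Unset Strict Implicit. Unset Printing Implicit Defensive.
Local Open Scope ring_scope.

(** Put T = t for odd t and T = t + 1 for even t. Enumerate the slopes of S_t as
    ... < s_(-1) < s_0 = 0 < s_1 < ..., with primitive vectors v_i = (b_i, a_i); consecutive ones
    satisfy det(v_i, v_(i+1)) = 1 and b_i + b_(i+1) >= T. After k steps the hull of U_k is bounded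
    by the supporting lines of these same slopes, the i-th one having risen by H_i(k) lattice
    lines. Its vertex between the slopes s_i and s_(i+1) then lies H_i b_(i+1) - H_(i+1) b_i
    columns away from the initial vertex, and this offset always stays in the window of the T
    columns centred at the initial vertex. A peeling step moves the offset by b_(i+1) if it is
    among the b_i lowest ones (then line i rises), and by -b_i if it is among the b_(i+1) highest
    ones (then line i+1 rises). The two ends of an edge of slope s_i run in opposite directions
    through the same residue class modulo b_i of their windows, so they agree on when line i rises,
    namely when at most two points are left on it. The offset map is the first return map, to T of
    b_i + b_(i+1) points, of a rotation; it is therefore a single cycle of length T, in which line
    i rises b_i times. So after T steps every supporting line has been shifted by (0, 1). *)

(** * Rises of the supporting lines *)

Lemma ltz_mulDl (B n r : int) : 0 <= r < B -> (n * B + r < B) = (n <= 0).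
Proof. by move=> hr; apply/idP/idP => h; nia. Qed.

Lemma count_ord_range (N u n : nat) (P : pred 'I_N) (s : seq 'I_N) :
  uniq s -> (forall y, P y -> (u <= y < u + n)%N) -> (count P s <= n)%N.
Proof.
move=> us hP; rewrite -size_filter -(size_map val) -(size_iota u n).
apply: uniq_leq_size; first by rewrite map_inj_uniq ?filter_uniq //; exact: val_inj.
by move=> _ /mapP[y + ->]; rewrite mem_filter mem_iota => /andP[/hP].
Qed.

Section Levels.

Variables (M : nat) (b c : int -> int).
Local Notation m := (M%:Z).
Local Notation N := (2 * M).+1.

Hypothesis b_gt0 : forall i : int, 0 < b i.
Hypothesis b_le : forall i : int, b i <= 2 * m + 1.
Hypothesis b_adjacent : forall i : int, 2 * m < b i + b (i + 1).
Hypothesis b_mediant : forall i : int, b i + b (i + 1 + 1) = c (i + 1) * b (i + 1).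

(* The hull vertex between the slopes [i] and [i + 1], once these slopes have risen by [H i] and
   [H (i + 1)] lattice lines, lies [drift H i] columns to the right of its initial position. *)
Definition drift (H : int -> int) (i : int) : int := H i * b (i + 1) - H (i + 1) * b i.

(** The test reads only the vertex [i], the right end of edge [i]; by [fires_left] the left end
    decides alike. *)
Definition fires (H : int -> int) (i : int) : bool := drift H i + m < b i.

Definition advance (H : int -> int) (i : int) : int := H i + (if fires H i then 1 else 0).

(* [level k i] is the number of lattice lines of slope [i] that have been used up after [k]
   peeling steps. *)
Fixpoint level (k : nat) : int -> int := if k is k'.+1 then advance (level k') else fun=> 0.

(* All [drift H i] stay in the window [-M, M], and the two ends of the edge of slope [i + 1] have
   moved the same number [j] of steps inwards since that edge appeared, counted within the residue
   classes modulo [b (i + 1)] of the two windows. *)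
Definition balanced (H : int -> int) : Prop := forall i : int,
  - m <= drift H i <= m /\
  exists j : int, [/\ 0 <= j,
    j * b (i + 1) <= m - drift H (i + 1) < (j + 1) * b (i + 1) &
    j * b (i + 1) <= m + drift H i < (j + 1) * b (i + 1)].

(** Change in the lattice length of edge [i + 1], which joins the vertices [i] and [i + 1]. *)
Definition elongation (H : int -> int) (i : int) : int :=
  c (i + 1) * H (i + 1) - H i - H (i + 1 + 1).

Lemma drift_diff (H : int -> int) (i : int) :
  drift H (i + 1) = drift H i + elongation H i * b (i + 1).
Proof.
have -> : elongation H i * b (i + 1) =
  H (i + 1) * (c (i + 1) * b (i + 1)) - H i * b (i + 1) - H (i + 1 + 1) * b (i + 1).
  by rewrite /elongation; ring.
by rewrite -b_mediant /drift; ring.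
Qed.

(** Divided by [b (i + 1)], both [m - drift H i] and [drift H (i + 1) + m] have quotient
    [j + elongation H i]; either test says that this quotient is at most 0. *)
Lemma fires_left (H : int -> int) (i : int) :
  balanced H -> fires H (i + 1) = (m - drift H i < b (i + 1)).
Proof.
move=> /(_ i) [_ [j [j0 hR hL]]]; have e := drift_diff H i.
have eR : m - drift H i = (j + elongation H i) * b (i + 1) +
    (m - drift H (i + 1) - j * b (i + 1)) by rewrite e; ring.
have eL : drift H (i + 1) + m = (j + elongation H i) * b (i + 1) +
    (m + drift H i - j * b (i + 1)) by rewrite e; ring.
by rewrite /fires eR eL !ltz_mulDl //; nia.
Qed.

Lemma balanced0 : balanced (fun=> 0).
Proof.
move=> i; rewrite /drift !mul0r subrr; split; first by lia.
exists (m %/ b (i + 1))%Z; have b0 := b_gt0 (i + 1).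
have := lez_floor m (lt0r_neq0 b0); have := ltz_ceil m b0; have := divz_ge0 m b0.
by rewrite lez_nat => hj h1 h2; split => //; lia.
Qed.

Lemma drift_advance (H : int -> int) (i : int) : drift (advance H) i =
  drift H i + (if fires H i then b (i + 1) else 0) - (if fires H (i + 1) then b i else 0).
Proof. by rewrite /drift /advance; do 2 case: ifP => _; ring. Qed.

(** The window has [2 * m + 1 <= b i + b (i + 1)] positions, so the [b i] lowest and the [b (i + 1)]
    highest ones cover it. *)
Lemma fires_adjacent (H : int -> int) (i : int) : balanced H -> fires H i || fires H (i + 1).
Proof.
move=> hH; rewrite fires_left // /fires; have := b_adjacent i => ad.
by case: ltP => //= ?; lia.
Qed.

Lemma balanced_advance (H : int -> int) : balanced H -> balanced (advance H).
Proof.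
move=> hH i.
have bnd (j : int) : - m <= drift (advance H) j <= m.
  have [/andP[h1 h2] _] := hH j; rewrite drift_advance fires_left // /fires.
  have := b_adjacent j; have := b_le j; have := b_le (j + 1) => l1 l0 ad.
  by do 2 case: ltP => ?; lia.
split; first exact: bnd.
have [fi|nfi] := boolP (fires H (i + 1)).
  (* A risen line carries a new edge, with both ends among the outermost [b (i + 1)] positions of
     their windows. *)
  exists 0; rewrite mul0r add0r mul1r.
  have hR : m - b (i + 1) < drift (advance H) (i + 1).
    have [/andP[h1 _] _] := hH (i + 1); have ad := b_adjacent (i + 1).
    by rewrite drift_advance fi fires_left //; case: ifPn => ?; lia.
  have hL : drift (advance H) i < b (i + 1) - m.
    have [/andP[_ h2] _] := hH i; have ad := b_adjacent i.
    by rewrite drift_advance fi /fires; case: ifPn => ?; lia.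
  by have := bnd i; have := bnd (i + 1); split; lia.
(* A resting line has two rising neighbours, so each end of its edge moves inwards by
   [b (i + 1)]. *)
have [_ [j [j0 hR hL]]] := hH i; exists (j + 1).
have := fires_adjacent i hH; have := fires_adjacent (i + 1) hH.
rewrite (negbTE nfi) orbF /= => f2 f0.
rewrite !drift_advance (negbTE nfi) f2 f0; split; lia.
Qed.

Lemma balanced_level k : balanced (level k).
Proof. by elim: k => [|k]; [exact: balanced0 | exact: balanced_advance]. Qed.

(** Since vertex [i + 1] stays in its window, [elongation H i + j >= 0]; adding the lower bounds for
    both ends gives [elongation H i + 2 * j <= q]. Hence [q + elongation H i >= 2 * (elongation H i
    + j) >= 0]: edges never turn back. *)
Lemma elongation_ge0 (H : int -> int) (i q t : int) : balanced H ->
  2 * m <= t -> t < (q + 1) * b (i + 1) -> 0 <= q + elongation H i.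
Proof.
move=> hH mt tq; have [_ [j [j0 hR hL]]] := hH i; have [/andP[hm _] _] := hH (i + 1).
have b0 := b_gt0 (i + 1); have e := drift_diff H i.
have h1 : 0 <= elongation H i + j by nia.
have h2 : elongation H i + 2 * j <= q by nia.
lia.
Qed.

(** Firing means [elongation H i + j <= 0], and the upper bounds for both ends give
    [q < elongation H i + 2 * j + 2]. So a rising line has at most two points left. *)
Lemma elongation_le1 (H : int -> int) (i q t : int) : balanced H -> fires H (i + 1) ->
  t <= 2 * m + 1 -> q * b (i + 1) <= t -> q + elongation H i <= 1.
Proof.
move=> hH fi mt tq; have [_ [j [j0 hR hL]]] := hH i; have [/andP[hm _] _] := hH (i + 1).
have b0 := b_gt0 (i + 1); have e := drift_diff H i.
have h1 : elongation H i + j <= 0 by move: fi; rewrite /fires; nia.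
have h2 : q < elongation H i + 2 * j + 2 by nia.
lia.
Qed.

(** One step of the position [drift H i + m] in [0 .. 2 * M]. The value stays in this range, so
    [inord] in [rot_step] never falls back to its default. *)
Definition shifted_rot (i : int) (y : 'I_N) : int :=
  y%:Z + (if y%:Z < b i then b (i + 1) else 0)
  - (if 2 * M%:Z - y%:Z < b (i + 1) then b i else 0).

Definition rot_step (i : int) (y : 'I_N) : 'I_N := inord `|shifted_rot i y|%N.

Lemma rot_stepE i y : (rot_step i y)%:Z = shifted_rot i y.
Proof.
have hy := ltn_ord y; have := b_adjacent i; have := b_le i; have := b_le (i + 1).
have := b_gt0 i; have := b_gt0 (i + 1) => *.
rewrite /rot_step /= inordK; last by rewrite /shifted_rot; do 2 case: ifPn => ?; lia.
by rewrite gez0_abs // /shifted_rot; do 2 case: ifPn => ?; lia.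
Qed.

(** The positions that move only up, only down, or both ways form three intervals with disjoint
    images. *)
Lemma rot_step_inj i : injective (rot_step i).
Proof.
move=> y z /(congr1 (fun y : 'I_N => y%:Z)); rewrite !rot_stepE /shifted_rot => e.
have hy := ltn_ord y; have hz := ltn_ord z; have := b_adjacent i.
have := b_gt0 i; have := b_gt0 (i + 1) => *.
by apply: val_inj => /=; move: e; do 4 case: ifPn => ?; lia.
Qed.

Lemma iter_rot_step i k : (iter k (rot_step i) (inord M))%:Z = drift (level k) i + m.
Proof.
elim: k => [|k IHk]; first by rewrite /= inordK ?ltnS ?leq_pmull // /drift !mul0r subrr add0r.
rewrite iterS rot_stepE /shifted_rot IHk [level k.+1](_ : _ = advance (level k)) //.
rewrite drift_advance fires_left; last exact: balanced_level.
rewrite /fires.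
have -> : 2 * m - (drift (level k) i + m) = m - drift (level k) i by ring.
ring.
Qed.

Lemma level_count i k : level k i =
  (count (fun y : 'I_N => y%:Z < b i) (traject (rot_step i) (inord M) k))%:Z /\
  level k (i + 1) =
  (count (fun y : 'I_N => 2 * m - y%:Z < b (i + 1)) (traject (rot_step i) (inord M) k))%:Z.
Proof.
elim: k => [//|k [IH1 IH2]]; rewrite !trajectSr -!cats1 !count_cat /= !addn0 !PoszD -IH1 -IH2.
rewrite !iter_rot_step /advance; split; first by rewrite /fires; case: ifP.
rewrite fires_left; last exact: balanced_level.
have -> : 2 * m - (drift (level k) i + m) = m - drift (level k) i by ring.
by case: ifP.
Qed.

(* By coprimality, the number of elements below [b i] of an orbit of [rot_step i] is a multiple of
   [b i], so the orbit contains all of them; likewise at the upper end of the window. *)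
Lemma level_period (i : int) : coprimez (b i) (b (i + 1)) -> level N i = b i.
Proof.
move=> b_coprime; set y0 : 'I_N := inord M; set R := order (rot_step i) y0.
have iR : iter R (rot_step i) y0 = y0 by apply: iter_order; exact: rot_step_inj.
have oE : orbit (rot_step i) y0 = traject (rot_step i) y0 R by [].
have uO : uniq (traject (rot_step i) y0 R) by rewrite -oE; exact: orbit_uniq.
have R_gt0 : (0 < R)%N by exact: order_gt0.
(* When the orbit closes up at the centre, the drift is zero again. *)
have d0 : level R i * b (i + 1) = level R (i + 1) * b i.
  have := iter_rot_step i R; rewrite -/y0 iR inordK ?ltnS ?leq_pmull //.
  rewrite /drift; lia.
have [c1 c2] := level_count i R; rewrite -/y0 in c1 c2.
have bi0 := b_gt0 i; have bj0 := b_gt0 (i + 1); have bil := b_le i; have bjl := b_le (i + 1).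
have cA s : uniq s -> (count (fun y : 'I_N => (y%:Z < b i)%R) s <= `|b i|)%N.
  by move=> us; apply: (@count_ord_range _ 0) => // y; lia.
have cB s : uniq s -> (count (fun y : 'I_N => (2 * m - y%:Z < b (i + 1))%R) s <= `|b (i + 1)|)%N.
  by move=> us; apply: (@count_ord_range _ (N - `|b (i + 1)|)) => // y; have := ltn_ord y; lia.
have adj (y : 'I_N) : (y%:Z < b i) || (2 * m - y%:Z < b (i + 1)).
  by have := b_adjacent i; lia.
have [e1 e2] : level R i = b i /\ level R (i + 1) = b (i + 1).
  have /dvdzP[u hu] : (b i %| level R i)%Z.
    by rewrite -(Gauss_dvdzl _ b_coprime) d0 dvdz_mull.
  have hv : level R (i + 1) = u * b (i + 1).
    by apply: (mulIf (lt0r_neq0 bi0)); rewrite -d0 hu; ring.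
  have u1 : u <= 1 by have := cA _ uO; rewrite -/y0; nia.
  have u0 : 0 <= u by nia.
  suff un0 : u != 0 by rewrite hu hv (_ : u = 1) ?mul1r //; lia.
  apply/eqP => uz; move: c1 c2; rewrite hu hv uz !mul0r.
  case: (R) R_gt0 => // r _ /=; have := adj y0; lia.
(* A missed position would lie in one of the two ends, but the orbit already fills both. *)
have inO z : z \in traject (rot_step i) y0 R.
  apply/negPn/negP => zO; have uz : uniq (z :: traject (rot_step i) y0 R) by rewrite /= zO.
  by have := adj z; have := cA _ uz; have := cB _ uz; rewrite /= -/y0; lia.
suff -> : N = R by [].
have := card_uniqP uO; rewrite size_traject => <-.
by rewrite -[LHS](card_ord N); apply: eq_card => z; rewrite inO.
Qed.

End Levels.

(** * The chain after some steps *)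

Lemma int_ind_from (P : int -> Prop) (i : int) :
  P i -> (forall j, i <= j -> P j -> P (j + 1)) -> forall j, i <= j -> P j.
Proof.
move=> Pi PS j ij; have -> : j = i + `|j - i|%N%:Z by lia.
elim: `|j - i|%N => [|n IH]; first by rewrite addr0.
by rewrite -addn1 PoszD addrA; apply: PS => //; lia.
Qed.

Lemma int_ind_below (P : int -> Prop) (i : int) :
  P i -> (forall j, j < i -> P (j + 1) -> P j) -> forall j, j <= i -> P j.
Proof.
move=> Pi PS j ji; have -> : j = i - `|i - j|%N%:Z by lia.
elim: `|i - j|%N => [|n IH]; first by rewrite subr0.
by apply: PS; [lia|]; rewrite (_ : _ + 1 = i - n%:Z) //; lia.
Qed.

(* [(b i, a i)] are the primitive edge vectors in order of slope, [q i] is the length of edge [i]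
   in lattice steps, and [(ex i, ey i)] is the right end of edge [i], relative to [(t / 2, 0)]. *)
Record slope_chain (t : nat) (b a c q ex ey : int -> int) : Prop := SlopeChain {
  chain_gt0 : forall i : int, 0 < b i;
  chain_le : forall i : int, b i <= t%:Z;
  chain_adjacent : forall i : int, t%:Z < b i + b (i + 1);
  chain_det : forall i : int, b i * a (i + 1) - a i * b (i + 1) = 1;
  chain_medb : forall i : int, b i + b (i + 1 + 1) = c (i + 1) * b (i + 1);
  chain_meda : forall i : int, a i + a (i + 1 + 1) = c (i + 1) * a (i + 1);
  chain_q_le : forall i : int, q i * b i <= t%:Z;
  chain_q_lt : forall i : int, t%:Z < (q i + 1) * b i;
  chain_ex : forall i : int, ex (i + 1) = ex i + q (i + 1) * b (i + 1);
  chain_ey : forall i : int, ey (i + 1) = ey i + q (i + 1) * a (i + 1)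
}.

Section Chain.

Variables (t : nat) (b a c q ex ey : int -> int).
Hypothesis ch : slope_chain t b a c q ex ey.

Local Notation drift := (drift b).
Local Notation elongation := (elongation c).

(** Index of the lattice line of slope [i] through [(X, Y)]: as [b i] and [a i] are coprime,
    neighbouring lattice lines differ by 1. *)
Definition height (i X Y : int) : int := b i * Y - a i * X.

Definition above (H : int -> int) (X Y : int) : Prop :=
  forall i : int, height i (ex i) (ey i) + H i <= height i X Y.

(** [vertx] and [verty] give the intersection of the risen lines [i] and [i + 1], integral because
    their determinant is 1. *)
Definition vertx (H : int -> int) (i : int) : int := ex i + drift H i.
Definition verty (H : int -> int) (i : int) : int := ey i + (H i * a (i + 1) - H (i + 1) * a i).

Definition len (H : int -> int) (i : int) : int := q (i + 1) + elongation H i.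

Lemma det_gt0 (i j : int) : i < j -> 0 < b i * a j - a i * b j.
Proof.
suff h : forall j, i + 1 <= j -> 0 < b i * a j - a i * b j by move=> ij; apply: h; lia.
apply: int_ind_from; first by rewrite (chain_det ch).
move=> {}j ij IH; have d1 := chain_det ch j.
have := chain_gt0 ch i; have := chain_gt0 ch j; have := chain_gt0 ch (j + 1) => b2 b1 b0.
rewrite -(pmulr_rgt0 _ b1).
have -> : b j * (b i * a (j + 1) - a i * b (j + 1)) =
  b i * (b j * a (j + 1) - a j * b (j + 1)) + b (j + 1) * (b i * a j - a i * b j) by ring.
by rewrite d1; nia.
Qed.

Lemma det_le (i j : int) : i <= j -> 0 <= b i * a j - a i * b j.
Proof.
rewrite le_eqVlt => /orP[/eqP <-|/det_gt0/ltW //].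
by rewrite mulrC subrr.
Qed.

Lemma vertx_succ (H : int -> int) (i : int) : vertx H (i + 1) = vertx H i + len H i * b (i + 1).
Proof. by rewrite /vertx (chain_ex ch) (drift_diff (chain_medb ch)) /len; ring. Qed.

Lemma verty_succ (H : int -> int) (i : int) : verty H (i + 1) = verty H i + len H i * a (i + 1).
Proof.
rewrite /verty (chain_ey ch) /len /elongation.
have := chain_meda ch i => e.
have -> : a (i + 1 + 1) = c (i + 1) * a (i + 1) - a i by rewrite -e; ring.
ring.
Qed.

Lemma height_vert (H : int -> int) (i : int) :
  height i (vertx H i) (verty H i) = height i (ex i) (ey i) + H i.
Proof.
rewrite /height /vertx /verty /drift.
have := chain_det ch i => e.
transitivity (b i * ey i - a i * ex i + H i * (b i * a (i + 1) - a i * b (i + 1))); first by ring.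
by rewrite e mulr1.
Qed.

Lemma height_succ (H : int -> int) (i j : int) :
  height i (vertx H (j + 1)) (verty H (j + 1)) =
  height i (vertx H j) (verty H j) + len H j * (b i * a (j + 1) - a i * b (j + 1)).
Proof. by rewrite vertx_succ verty_succ /height; ring. Qed.

Lemma height_vertS (H : int -> int) (i : int) :
  height (i + 1) (vertx H i) (verty H i) = height (i + 1) (ex (i + 1)) (ey (i + 1)) + H (i + 1).
Proof.
have := height_succ H (i + 1) i; rewrite height_vert => ->.
by rewrite [X in len H i * X](_ : _ = 0) ?mulr0 ?addr0 //; ring.
Qed.

Lemma ex_grows (i : int) (n : nat) : ex i + n%:Z <= ex (i + n%:Z).
Proof.
elim: n => [|n IH]; first by rewrite !addr0.
rewrite (_ : n.+1%:Z = n%:Z + 1) ?addrA ?(chain_ex ch); last by lia.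
have := chain_q_lt ch (i + n%:Z + 1); have := chain_le ch (i + n%:Z + 1).
have := chain_gt0 ch (i + n%:Z + 1) => B0 Bt tB.
apply: lerD => //; move: (b _) (q _) B0 Bt tB => B Q B0 Bt tB.
by have Q1 : 1 <= Q; nia.
Qed.

Lemma above_up (H : int -> int) (X Y : int) : above H X Y -> above H X (Y + 1).
Proof. by move=> h i; have := h i; have := chain_gt0 ch i; rewrite /height; lia. Qed.

Section Step.

Variables (M : nat) (H : int -> int).
Local Notation fires := (fires M b).
Hypothesis tM : (2 * M <= t <= (2 * M).+1)%N.
Hypothesis hH : balanced M b H.

Lemma len_ge0 (i : int) : 0 <= len H i.
Proof.
by apply: (elongation_ge0 (chain_gt0 ch) (chain_medb ch) hH _ (chain_q_lt ch _)); lia.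
Qed.

Lemma len_le1 (i : int) : fires H (i + 1) -> len H i <= 1.
Proof.
move=> fi.
by apply: (elongation_le1 (chain_gt0 ch) (chain_medb ch) hH fi _ (chain_q_le ch _)); lia.
Qed.

(** Along the chain away from edge [j], the height of slope [j] never drops, because lengths are
    nonnegative and slopes increase. *)
Lemma above_vert (i : int) : above H (vertx H i) (verty H i).
Proof.
move=> j; rewrite -height_vert.
have [|/ltW] := leP j i.
  move: i; apply: int_ind_from => // k jk; rewrite height_succ => IH.
  have l0 := len_ge0 k; have d0 : 0 <= b j * a (k + 1) - a j * b (k + 1) by apply: det_le; lia.
  by rewrite (le_trans IH) // lerDl mulr_ge0.
move: i; apply: int_ind_below => // k kj; rewrite height_succ => IH.
have l0 := len_ge0 k; have d0 : 0 <= b (k + 1) * a j - a (k + 1) * b j by apply: det_le; lia.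
by rewrite (le_trans IH) // gerDl mulr_ge0_le0 //; lia.
Qed.

Lemma fires_either (i : int) : fires H i || fires H (i + 1).
Proof.
apply: (@fires_adjacent _ _ c) => //; last exact: (chain_medb ch).
by move=> j; have := chain_adjacent ch j; lia.
Qed.

(** The lines [i] and [i + 1 + 1] confine the point to edge [i + 1], and a rising edge has length at
    most 1. *)
Lemma above_line (i X Y : int) : above H X Y -> fires H (i + 1) ->
  height (i + 1) X Y = height (i + 1) (ex (i + 1)) (ey (i + 1)) + H (i + 1) ->
  (X = vertx H i /\ Y = verty H i) \/ (X = vertx H (i + 1) /\ Y = verty H (i + 1)).
Proof.
move=> hXY fi; rewrite -height_vertS => hi.
have := hXY i; rewrite -height_vert => h0.
have := hXY (i + 1 + 1); rewrite -height_vertS => h2.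
have d1 := chain_det ch i; have d2 := chain_det ch (i + 1).
have l0 := len_ge0 i; have l1 := len_le1 fi.
(* Number of lattice steps from vertex [i] along the line; the next two identities are Cramer's rule
   with determinant 1. *)
set s := height i X Y - height i (vertx H i) (verty H i).
have eX : X = vertx H i + s * b (i + 1).
  transitivity (X * (b i * a (i + 1) - a i * b (i + 1))); first by rewrite d1 mulr1.
  transitivity (vertx H i * (b i * a (i + 1) - a i * b (i + 1)) + s * b (i + 1) -
     b i * (height (i + 1) X Y - height (i + 1) (vertx H i) (verty H i))); last first.
    by rewrite d1 hi; ring.
  by rewrite /s /height; ring.
have eY : Y = verty H i + s * a (i + 1).
  transitivity (Y * (b i * a (i + 1) - a i * b (i + 1))); first by rewrite d1 mulr1.
  transitivity (verty H i * (b i * a (i + 1) - a i * b (i + 1)) + s * a (i + 1) -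
     a i * (height (i + 1) X Y - height (i + 1) (vertx H i) (verty H i))); last first.
    by rewrite d1 hi; ring.
  by rewrite /s /height; ring.
have s0 : 0 <= s by rewrite /s; lia.
have s1 : s <= len H i.
  move: h2; rewrite eX eY vertx_succ verty_succ /height.
  rewrite -subr_ge0 [X in 0 <= X](_ : _ = (len H i - s) *
   (b (i + 1) * a (i + 1 + 1) - a (i + 1) * b (i + 1 + 1))); last by ring.
  by rewrite d2; lia.
have [sz|sz] : s = 0 \/ s = len H i by lia.
  by left; rewrite eX eY sz !mul0r !addr0.
by right; rewrite vertx_succ verty_succ -sz.
Qed.

(** Every vertex lies on a rising line by [fires_either], and by [above_line] a rising line meets
    the region in vertices only. *)
Lemma above_advance (X Y : int) : above H X Y ->
  above (advance M b H) X Y <-> forall i : int, ~ (X = vertx H i /\ Y = verty H i).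
Proof.
move=> hXY; split=> [hA i [eX eY]|nv i].
  have [] := orP (fires_either i) => fi.
    by have := hA i; rewrite /advance fi eX eY height_vert; lia.
  by have := hA (i + 1); rewrite /advance fi eX eY height_vertS; lia.
rewrite /advance; case: ifPn => [fi|_]; last by rewrite addr0; exact: hXY.
have := hXY i; rewrite le_eqVlt => /orP[/eqP e|]; last by lia.
have e' : i = i - 1 + 1 by lia.
rewrite e' in fi e; have [/nv|/nv] // := above_line hXY fi (esym e).
Qed.

Lemma above_advanceW (X Y : int) : above (advance M b H) X Y -> above H X Y.
Proof. by move=> h i; apply: le_trans (h i); rewrite lerD2l /advance lerDl; case: ifP. Qed.

(** Vertices stay within [M] columns of their initial places, which run off to infinity on both
    sides by [ex_grows]. *)
Lemma vert_cover (X : int) : exists i : int, vertx H i <= X <= vertx H (i + 1).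
Proof.
have bnd (i : int) : ex i - M%:Z <= vertx H i <= ex i + M%:Z.
  by have [h _] := hH i; rewrite /vertx; lia.
pose i0 : int := - `|ex 0 - X|%N%:Z - M%:Z.
have h0 : vertx H i0 <= X.
  have := ex_grows i0 (`|ex 0 - X| + M); rewrite (_ : i0 + _ = 0); last by rewrite /i0; lia.
  by have := bnd i0; lia.
have : exists n : nat, X <= vertx H (i0 + n%:Z).
  exists (`|X - ex i0| + M)%N.
  by have := ex_grows i0 (`|X - ex i0| + M); have := bnd (i0 + (`|X - ex i0| + M)%N%:Z); lia.
move=> ex_n; case: (ex_minnP ex_n) => {ex_n} -[|n] hn mn.
  exists i0; rewrite addr0 in hn; rewrite h0 vertx_succ.
  by have := len_ge0 i0; have := chain_gt0 ch (i0 + 1); nia.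
exists (i0 + n%:Z); rewrite (_ : i0 + n%:Z + 1 = i0 + n.+1%:Z) ?hn ?andbT; last by lia.
by case: leP => // /ltW /mn; rewrite ltnn.
Qed.

End Step.

End Chain.

(** * Convex hulls and one peeling step *)

Lemma conv_halfplane (U : pt -> Prop) (u v C : rat) (p : pt) :
  (forall q, U q -> C <= v * q.2 - u * q.1) -> conv U p -> C <= v * p.2 - u * p.1.
Proof.
move=> hU [n [w [q [Uq [w0 [w1 [-> ->]]]]]]].
have -> : C = \sum_(i < n) w i * C by rewrite -mulr_suml w1 mul1r.
rewrite !mulr_sumr -sumrB; apply: ler_sum => i _.
have -> : v * (w i * (q i).2) - u * (w i * (q i).1) = w i * (v * (q i).2 - u * (q i).1) by ring.
by apply: ler_wpM2l; [exact: w0 | exact/hU/Uq].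
Qed.

Lemma conv_segment (U : pt -> Prop) (p q : pt) (l : rat) : U p -> U q -> 0 <= l <= 1 ->
  conv U (l * p.1 + (1 - l) * q.1, l * p.2 + (1 - l) * q.2).
Proof.
move=> Up Uq hl.
exists 2, (fun i => if i == 0 :> nat then l else 1 - l), (fun i => if i == 0 :> nat then p else q).
split; first by move=> i; case: ifP.
split; first by move=> i; case: ifP => _; lra.
by rewrite !big_ord_recl !big_ord0 /= !addr0 addrC subrK.
Qed.

Lemma conv_in (U : pt -> Prop) (p : pt) : U p -> conv U p.
Proof.
move=> Up; have := @conv_segment U p p 1 Up Up; rewrite subrr !mul0r !addr0 !mul1r ler01 lexx.
by move=> /(_ isT); case: p Up.
Qed.

Lemma conv_extW (U V : pt -> Prop) (p : pt) : (forall q, U q -> V q) -> conv U p -> conv V p.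
Proof.
move=> UV [n [w [q [Uq h]]]]; exists n, w, q; split=> // i; exact: UV.
Qed.

(** Sets are predicates compared pointwise, so iterating the description of one step needs this
    compatibility. *)
Lemma peel_ext (U V : pt -> Prop) : (forall p, U p <-> V p) -> forall p, peel U p <-> peel V p.
Proof.
have W (A B : pt -> Prop) : (forall p, A p <-> B p) -> forall p, peel A p -> peel B p.
  move=> AB p [Ap nex]; split; first exact/AB.
  move=> [Bp ex]; apply: nex; split; first exact: conv_in.
  move=> x y l Ax Ay; apply: ex.
    by apply: conv_extW Ax => q /AB.
  by apply: conv_extW Ay => q /AB.
move=> UV p; split; apply: W => // q; exact: iff_sym (UV q).
Qed.

(** Two independent linear forms are minimal at [p]. On a segment with [p] in its interior both must
    be constant, so its ends coincide. *)
Lemma extreme_corner (U : pt -> Prop) (u1 v1 u2 v2 : rat) (p : pt) : v1 * u2 - u1 * v2 = 1 ->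
  (forall q, U q -> v1 * p.2 - u1 * p.1 <= v1 * q.2 - u1 * q.1) ->
  (forall q, U q -> v2 * p.2 - u2 * p.1 <= v2 * q.2 - u2 * q.1) ->
  U p -> extreme (conv U) p.
Proof.
move=> det h1 h2 Up; split; first exact: conv_in.
move=> x y l Cx Cy /andP[l0 l1] ep.
have ep1 : p.1 = l * x.1 + (1 - l) * y.1 by rewrite ep.
have ep2 : p.2 = l * x.2 + (1 - l) * y.2 by rewrite ep.
have tight u v : v * p.2 - u * p.1 <= v * x.2 - u * x.1 ->
    v * p.2 - u * p.1 <= v * y.2 - u * y.1 -> v * x.2 - u * x.1 = v * y.2 - u * y.1.
  have -> : v * p.2 - u * p.1 = l * (v * x.2 - u * x.1) + (1 - l) * (v * y.2 - u * y.1).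
    by rewrite ep1 ep2; ring.
  move: (v * x.2 - u * x.1) (v * y.2 - u * y.1) => A B hA hB.
  have k0 : 0 < 1 - l by rewrite subr_gt0.
  have : (1 - l) * (B - A) <= 0 by lra.
  rewrite pmulr_rle0 // => BA.
  have : l * (A - B) <= 0 by lra.
  by rewrite pmulr_rle0 // => AB; apply/eqP; rewrite eq_le; lra.
have t1 := tight _ _ (conv_halfplane h1 Cx) (conv_halfplane h1 Cy).
have t2 := tight _ _ (conv_halfplane h2 Cx) (conv_halfplane h2 Cy).
have e1 : x.1 = y.1.
  rewrite -[LHS]mul1r -[RHS]mul1r -det.
  have -> : (v1 * u2 - u1 * v2) * x.1 =
    v2 * (v1 * x.2 - u1 * x.1) - v1 * (v2 * x.2 - u2 * x.1) by ring.
  by rewrite t1 t2; ring.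
have e2 : x.2 = y.2.
  rewrite -[LHS]mul1r -[RHS]mul1r -det.
  have -> : (v1 * u2 - u1 * v2) * x.2 =
    u2 * (v1 * x.2 - u1 * x.1) - u1 * (v2 * x.2 - u2 * x.1) by ring.
  by rewrite t1 t2; ring.
by case: x y e1 e2 {Cx Cy ep ep1 ep2 tight t1 t2} => [x1 x2] [y1 y2] /= -> ->.
Qed.

Lemma not_extreme_between (C : pt -> Prop) (p x y : pt) (l : rat) : C x -> C y -> 0 < l < 1 ->
  p = (l * x.1 + (1 - l) * y.1, l * x.2 + (1 - l) * y.2) -> x <> y -> ~ extreme C p.
Proof. by move=> Cx Cy l01 ep xy [_ /(_ x y l Cx Cy l01 ep)]. Qed.

(* [r] is the point of the segment [x y] below [p]; either [p = r] or [p] lies between [r]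
   and the point one unit above [p]. *)
Lemma not_extreme_above (U : pt -> Prop) (p x y : pt) (l : rat) : U x -> U y ->
  U (p.1, p.2 + 1) -> 0 < l < 1 -> x.1 != y.1 -> p.1 = l * x.1 + (1 - l) * y.1 ->
  l * x.2 + (1 - l) * y.2 <= p.2 -> ~ extreme (conv U) p.
Proof.
move=> Ux Uy Up l01 xy e1; rewrite le_eqVlt => /orP[/eqP e2|lt2].
  apply: (@not_extreme_between _ p x y l) => //; [exact: conv_in|exact: conv_in| |].
    by rewrite -e1 e2; case: (p).
  by move=> xey; rewrite xey eqxx in xy.
set r := l * x.2 + (1 - l) * y.2 in lt2.
set mu := (p.2 + 1 - r)^-1.
have d0 : 0 < p.2 + 1 - r by lra.
have mu0 : 0 < mu by rewrite invr_gt0.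
have mu1 : mu < 1 by rewrite invf_lt1 //; lra.
apply: (@not_extreme_between _ p (p.1, r) (p.1, p.2 + 1) mu).
- by rewrite e1; apply: conv_segment => //; lra.
- exact: conv_in.
- by rewrite mu0.
- rewrite /= -mulrDl addrC subrK mul1r.
  have -> : mu * r + (1 - mu) * (p.2 + 1) = p.2 + 1 - mu * (p.2 + 1 - r) by ring.
  by rewrite mulVf ?gt_eqF // addrK; case: (p).
- by move=> [] e; lra.
Qed.

Section Region.

Variables (t M : nat) (b a c q ex ey : int -> int) (d : rat).
Hypothesis ch : slope_chain t b a c q ex ey.
Hypothesis tM : (2 * M <= t <= (2 * M).+1)%N.

Definition region (H : int -> int) (p : pt) : Prop :=
  exists X Y : int, p = (d + X%:~R, Y%:~R) /\ above b a ex ey H X Y.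

Lemma extreme_vert (H : int -> int) (i : int) : balanced M b H ->
  extreme (conv (region H)) (d + (vertx b ex H i)%:~R, (verty a ey H i)%:~R).
Proof.
move=> hH; apply: (@extreme_corner _ (a i)%:~R (b i)%:~R (a (i + 1))%:~R (b (i + 1))%:~R) => /=.
- by rewrite -!intrM -intrB (chain_det ch).
- move=> _ [X [Y [-> hXY]]] /=; have := hXY i; rewrite -(height_vert ch) /height => h.
  suff : (b i * verty a ey H i - a i * vertx b ex H i)%:~R <= (b i * Y - a i * X)%:~R :> rat.
    by rewrite !intrB !intrM; lra.
  by rewrite ler_int.
- move=> _ [X [Y [-> hXY]]] /=; have := hXY (i + 1); rewrite -(height_vertS ch) /height => h.
  suff : (b (i + 1) * verty a ey H i - a (i + 1) * vertx b ex H i)%:~R <=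
         (b (i + 1) * Y - a (i + 1) * X)%:~R :> rat.
    by rewrite !intrB !intrM; lra.
  by rewrite ler_int.
- exists (vertx b ex H i), (verty a ey H i); split=> //; exact: (above_vert ch tM).
Qed.

(** In the column of a vertex, the point lies midway between two points of the region; in any other
    column it lies on or above the interior of an edge. *)
Lemma not_extreme_region (H : int -> int) (X Y : int) : balanced M b H ->
  above b a ex ey H X Y -> (forall i, ~ (X = vertx b ex H i /\ Y = verty a ey H i)) ->
  ~ extreme (conv (region H)) (d + X%:~R, Y%:~R).
Proof.
move=> hH hXY nv.
have inR A B : above b a ex ey H A B -> region H (d + A%:~R, B%:~R) by exists A, B.
have column i : X = vertx b ex H i -> ~ extreme (conv (region H)) (d + X%:~R, Y%:~R).
  move=> eX; have lt : verty a ey H i < Y.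
    have := hXY i; rewrite -(height_vert ch) /height eX => h.
    have bi := chain_gt0 ch i; rewrite lt_neqAle; apply/andP; split.
      by apply/eqP => eY; apply: (nv i).
    by rewrite -(ler_pM2l bi); lia.
  have down : above b a ex ey H X (Y - 1).
    move=> j; apply: le_trans (above_vert ch tM hH i j) _.
    by rewrite /height eX lerD2r (ler_pM2l (chain_gt0 ch j)); lia.
  apply: (@not_extreme_between _ _ (d + X%:~R, (Y - 1)%:~R) (d + X%:~R, (Y + 1)%:~R) (1 / 2)).
  - exact/conv_in/inR.
  - apply/conv_in/inR; exact: (above_up ch).
  - by lra.
  - by rewrite /= intrB intrD; congr pair; field.
  - by move=> [] /intr_inj; lia.
have [i /andP[]] := vert_cover ch tM hH X.
rewrite le_eqVlt => /orP[/eqP/esym eX _|lt1]; first exact: (column i).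
rewrite le_eqVlt => /orP[/eqP eX|lt2]; first exact: (column (i + 1)).
have lt12 := lt_trans lt1 lt2.
set x0 := vertx b ex H i in lt1 lt12; set x1 := vertx b ex H (i + 1) in lt2 lt12.
have lt1' : x0%:~R < X%:~R :> rat by rewrite ltr_int.
have lt2' : X%:~R < x1%:~R :> rat by rewrite ltr_int.
have D0 : 0 < x1%:~R - x0%:~R :> rat by lra.
(* This weight puts the combination of the two vertices into column [X]. *)
set l : rat := (x1%:~R - X%:~R) / (x1%:~R - x0%:~R).
have lD : l * (x1%:~R - x0%:~R) = x1%:~R - X%:~R by rewrite divfK ?gt_eqF.
apply: (@not_extreme_above _ _ (d + x0%:~R, (verty a ey H i)%:~R)
   (d + x1%:~R, (verty a ey H (i + 1))%:~R) l).
- apply/inR; exact: (above_vert ch tM).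
- apply/inR; exact: (above_vert ch tM).
- by have := inR _ _ (above_up ch hXY); rewrite intrD.
- apply/andP; split; first by rewrite divr_gt0 // subr_gt0.
  by rewrite /l ltr_pdivrMr // mul1r; lra.
- by rewrite /= (inj_eq (addrI _)) lt_eqF //; lra.
- by move: lD; rewrite /=; lra.
- have bi := chain_gt0 ch (i + 1).
  have := hXY (i + 1); rewrite -(height_vertS ch) /height -/x0 => h.
  have bR : 0 < (b (i + 1))%:~R :> rat by rewrite ltr0z.
  rewrite /= (verty_succ ch) -(ler_pM2l bR) intrD intrM.
  have eL : (len c q H i)%:~R * (b (i + 1))%:~R = x1%:~R - x0%:~R :> rat.
    by rewrite /x1 (vertx_succ ch) intrD intrM -/x0; ring.
  move: h; rewrite -(ler_int rat) !intrB !intrM => h.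
  set A : rat := (a (i + 1))%:~R in h *; set B : rat := (b (i + 1))%:~R in h eL bR *.
  set E : rat := (len c q H i)%:~R in eL *; set Y0 : rat := (verty a ey H i)%:~R in h *.
  have -> : B * (l * Y0 + (1 - l) * (Y0 + E * A)) = B * Y0 + A * ((E * B) - l * (E * B)) by ring.
  by rewrite eL lD; lra.
Qed.

Lemma peel_region (H : int -> int) (p : pt) : balanced M b H ->
  peel (region H) p <-> region (advance M b H) p.
Proof.
move=> hH; split=> [[[X [Y [-> hXY]]] nex]|[X [Y [-> hXY]]]].
  exists X, Y; split=> //; apply/(above_advance ch tM hH hXY) => i [eX eY].
  by apply: nex; rewrite eX eY; exact: extreme_vert.
have hXY' := above_advanceW hXY; split; first by exists X, Y.
by apply: not_extreme_region => //; apply/(above_advance ch tM hH hXY').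
Qed.

End Region.

(** * Enumeration of the slopes *)

Section Farey.

Variable t : nat.
Hypothesis t_gt0 : (0 < t)%N.

(** Next-term recurrence of the Farey sequence of order [t], continued beyond 1, on pairs
    (denominator, numerator) starting with 0/1 and 1/t. *)
Fixpoint farey_pair (n : nat) : (int * int) * (int * int) :=
  if n is n'.+1 then
    let: (u, v) := farey_pair n' in
    let C := ((t%:Z + u.1) %/ v.1)%Z in (v, (C * v.1 - u.1, C * v.2 - u.2))
  else ((1, 0), (t%:Z, 1)).

Definition farey (n : nat) : int * int := (farey_pair n).1.

Lemma farey_pairE n : farey_pair n = (farey n, farey n.+1).
Proof. by rewrite /farey /=; case: (farey_pair n). Qed.

(** The quotient makes the next denominator the largest value up to [t] in its residue class, and
    the recurrence preserves the determinant. *)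
Lemma fareyP n :
  [/\ 0 < (farey n).1 <= t%:Z, 0 < (farey n.+1).1 <= t%:Z,
      t%:Z < (farey n).1 + (farey n.+1).1 &
      (farey n).1 * (farey n.+1).2 - (farey n).2 * (farey n.+1).1 = 1].
Proof.
elim: n => [|n]; first by rewrite /farey /=; split; lia.
have -> : farey n.+2 = (((t%:Z + (farey n).1) %/ (farey n.+1).1)%Z * (farey n.+1).1 - (farey n).1,
   ((t%:Z + (farey n).1) %/ (farey n.+1).1)%Z * (farey n.+1).2 - (farey n).2).
  have : farey n.+2 = (farey_pair n.+1).2 by rewrite farey_pairE.
  by rewrite /= farey_pairE.
move: (farey n) (farey n.+1) => [b a] [b' a'] /= [b0 b'0 ad det].
have := lez_floor (t%:Z + b) (lt0r_neq0 (proj1 (andP b'0))).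
have := ltz_ceil (t%:Z + b) (proj1 (andP b'0)).
move: (_ %/ _)%Z => C h1 h2; by split => //; lia.
Qed.

(* [fa i / fb i] is the [i]-th element of S_t counted from [fa 0 / fb 0 = 0], negative slopes
   being obtained by reflection. *)
Definition fb (i : int) : int := (farey `|i|%N).1.
Definition fa (i : int) : int := if 0 <= i then (farey `|i|%N).2 else - (farey `|i|%N).2.
(** By Cramer's rule, the determinant of the two neighbours is the factor by which their sum is a
    multiple of vector [i]. *)
Definition fc (i : int) : int := fb (i - 1) * fa (i + 1) - fa (i - 1) * fb (i + 1).
Definition fq (i : int) : int := (t%:Z %/ fb i)%Z.
(** For negative [i] the edges [0, -1, ..., i + 1] are subtracted. Reflection preserves widths and
    negates heights, hence the minus sign here and none in [fey]. *)
Definition fex (i : int) : int :=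
  match i with
  | Posz n => \sum_(0 <= j < n) fq j.+1%:Z * fb j.+1%:Z
  | Negz n => - \sum_(0 <= j < n.+1) fq j%:Z * fb j%:Z
  end.
Definition fey (i : int) : int :=
  match i with
  | Posz n => \sum_(0 <= j < n) fq j.+1%:Z * fa j.+1%:Z
  | Negz n => \sum_(0 <= j < n.+1) fq j%:Z * fa j%:Z
  end.

Lemma fb_bounds (i : int) : 0 < fb i <= t%:Z.
Proof. by have [] := fareyP `|i|%N. Qed.

Lemma fbN (i : int) : fb (- i) = fb i. Proof. by rewrite /fb abszN. Qed.

Lemma fqN (i : int) : fq (- i) = fq i. Proof. by rewrite /fq fbN. Qed.

Lemma faN (i : int) : fa (- i) = - fa i.
Proof.
rewrite /fa abszN oppr_ge0; case: (ltgtP i 0) => [_|_|->]; by rewrite ?opprK.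
Qed.

Lemma int_succP (P : int -> Prop) :
  (forall n : nat, P n%:Z) -> (forall n : nat, P (- n.+1%:Z)) -> forall i, P i.
Proof. by move=> Pn Pm [n|n]; [exact: Pn | rewrite NegzE; exact: Pm]. Qed.

Lemma succ_nat (n : nat) : n%:Z + 1 = n.+1%:Z. Proof. by lia. Qed.

Lemma succ_neg (n : nat) : - n.+1%:Z + 1 = - n%:Z. Proof. by lia. Qed.

Lemma farey_chain : slope_chain t fb fa fc fq fex fey.
Proof.
have det (i : int) : fb i * fa (i + 1) - fa i * fb (i + 1) = 1.
  elim/int_succP: i => n; first by rewrite succ_nat /fb /fa /=; have [] := fareyP n.
  rewrite succ_neg !faN !fbN /fb /fa /=; have [_ _ _ <-] := fareyP n; ring.
have gt0 (i : int) : 0 < fb i by case/andP: (fb_bounds i).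
split=> //.
- by move=> i; case/andP: (fb_bounds i).
- elim/int_succP => n; first by rewrite succ_nat /fb /=; have [] := fareyP n.
  by rewrite succ_neg !fbN /fb /= addrC; have [] := fareyP n.
- move=> i; rewrite /fc addrK.
  transitivity (fb i * (fb (i + 1) * fa (i + 1 + 1) - fa (i + 1) * fb (i + 1 + 1)) +
    (fb i * fa (i + 1) - fa i * fb (i + 1)) * fb (i + 1 + 1)); last by ring.
  by rewrite !det; ring.
- move=> i; rewrite /fc addrK.
  transitivity (fa i * (fb (i + 1) * fa (i + 1 + 1) - fa (i + 1) * fb (i + 1 + 1)) +
    (fb i * fa (i + 1) - fa i * fb (i + 1)) * fa (i + 1 + 1)); last by ring.
  by rewrite !det; ring.
- by move=> i; apply: lez_floor; exact: lt0r_neq0.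
- by move=> i; apply: ltz_ceil.
- elim/int_succP => n; first by rewrite succ_nat /= big_nat_recr.
  rewrite succ_neg fqN fbN -NegzE; case: n => [|n].
    by rewrite oppr0 /= big_geq // big_nat1 addNr.
  by rewrite -NegzE /= [in RHS]big_nat_recr //=; ring.
- elim/int_succP => n; first by rewrite succ_nat /= big_nat_recr.
  rewrite succ_neg fqN faN -NegzE; case: n => [|n].
    by rewrite oppr0 /= big_geq // big_nat1 (_ : fa 0%N = 0) // mulr0 addr0.
  by rewrite -NegzE /= [in RHS]big_nat_recr //=; ring.
Qed.

Definition slope (i : int) : rat := (fa i)%:~R / (fb i)%:~R.

Lemma farey_coprime (i : int) : coprimez (fb i) (fa i).
Proof.
apply/coprimezP; exists (fa (i + 1), - fb (i + 1)) => /=.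
by apply: etrans (chain_det farey_chain i); ring.
Qed.

Lemma fb_coprime (i : int) : coprimez (fb i) (fb (i + 1)).
Proof.
apply/coprimezP; exists (fa (i + 1), - fa i) => /=.
by apply: etrans (chain_det farey_chain i); ring.
Qed.

Lemma denq_slope (i : int) : denq (slope i) = fb i.
Proof.
have /andP[b0 _] := fb_bounds i; have := farey_coprime i.
rewrite /coprimez /slope => h; rewrite coprimeq_den.
  by rewrite gt_eqF // gtr0_norm.
by move: h; rewrite /gcdz eqz_nat gcdnC.
Qed.

Lemma numq_slope (i : int) : numq (slope i) = fa i.
Proof.
have /andP[b0 _] := fb_bounds i; have := farey_coprime i.
rewrite /coprimez /slope => h; rewrite coprimeq_num.
  by rewrite gtr0_sg // mul1r.
by move: h; rewrite /gcdz eqz_nat gcdnC.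
Qed.

Lemma slope_lt (i j : int) : i < j -> slope i < slope j.
Proof.
move=> /(det_gt0 farey_chain); have /andP[bi _] := fb_bounds i; have /andP[bj _] := fb_bounds j.
move=> h; rewrite /slope ltr_pdivrMr ?ltr0z // mulrAC ltr_pdivlMr ?ltr0z //.
by rewrite -!intrM ltr_int -subr_gt0 [fa j * _]mulrC.
Qed.

Lemma slope_mono (i j : int) : (slope i < slope j) = (i < j).
Proof.
case: (ltgtP i j) => [/slope_lt -> //|/slope_lt/ltW h|->]; last by rewrite ltxx.
by apply/negbTE; rewrite -leNgt.
Qed.

Lemma slope_inj : injective slope.
Proof.
move=> i j e; have := slope_mono i j; have := slope_mono j i; rewrite e ltxx.
by case: (ltgtP i j).
Qed.

Lemma slopeN (i : int) : slope (- i) = - slope i.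
Proof. by rewrite /slope fbN faN intrN mulNr. Qed.

Lemma slope0 : slope 0 = 0.
Proof. by rewrite /slope /fa /farey /= mul0r. Qed.

(** Consecutive slopes differ by the inverse product of their denominators, at least [1 / t^2];
    hence the slopes are unbounded. *)
Lemma farey_growth (n : nat) : n%:Z * fb n <= fa n * (t%:Z * t%:Z).
Proof.
elim: n => [|n IH]; first by rewrite mul0r /fa /farey /= mul0r.
have := chain_det farey_chain n; rewrite succ_nat => det.
have /andP[b0 bt] := fb_bounds n; have /andP[b0' bt'] := fb_bounds n.+1.
rewrite -(ler_pM2l b0).
have -> : fb n * (fa n.+1 * (t%:Z * t%:Z)) =
  fb n.+1 * (fa n * (t%:Z * t%:Z)) + (fb n * fa n.+1 - fa n * fb n.+1) * (t%:Z * t%:Z) by ring.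
rewrite det mul1r.
have -> : fb n * (n.+1%:Z * fb n.+1) = fb n.+1 * (n%:Z * fb n) + fb n * fb n.+1.
  by rewrite -succ_nat; ring.
apply: lerD; first by rewrite ler_pM2l.
by apply: ler_pM => //; exact: ltW.
Qed.

Lemma slope_surj_ge0 (s : rat) : inS t s -> 0 <= s -> exists n : nat, s = slope n%:Z.
Proof.
rewrite /inS => sS s0; have A0 : 0 <= numq s by rewrite numq_ge0.
have B0 : 0 < denq s := denq_gt0 s.
set A := numq s in A0 *; set B := denq s in sS B0 *.
have ex_n : exists n : nat, fb n * A - fa n * B < 0.
  (* By [farey_growth] the slope with this index exceeds [A], hence also [s]. *)
  exists (`|A| * (t * t)).+1%N.
  have := farey_growth (`|A| * (t * t)).+1%N; have /andP[b0 bt] := fb_bounds (`|A| * (t * t)).+1%N.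
  move: (fb _) (fa _) b0 => b a b0.
  rewrite -succ_nat PoszM gez0_abs // PoszM => h.
  have tt : 0 < t%:Z * t%:Z by nia.
  have h' : (t%:Z * t%:Z) * (A * b) < (t%:Z * t%:Z) * a by nia.
  rewrite (ltr_pM2l tt) in h'.
  have a0 : 0 <= a by nia.
  nia.
case: (ex_minnP ex_n) => -[|n] hn mn.
  by move: hn; rewrite /fb /fa /farey /=; lia.
have D0 : 0 <= fb n * A - fa n * B.
  by rewrite leNgt; apply/negP => /mn; rewrite ltnn.
have /andP[b0 _] := fb_bounds n; have /andP[b0' _] := fb_bounds n.+1.
have D1 : fb n * A - fa n * B = 0.
  apply/eqP; rewrite eq_le D0 andbT leNgt; apply/negP => D1.
  have := chain_det farey_chain n; rewrite succ_nat => det.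
  have := chain_adjacent farey_chain n; rewrite succ_nat => ad.
  (* If [s] lay strictly between two neighbours, both coefficients in their basis would be at least
     1, forcing [B >= fb n + fb n.+1 > t]. *)
  have eB : B = fb n.+1 * (fb n * A - fa n * B) - fb n * (fb n.+1 * A - fa n.+1 * B).
    transitivity (B * (fb n * fa n.+1 - fa n * fb n.+1)); first by rewrite det mulr1.
    ring.
  have h1 : fb n.+1 <= fb n.+1 * (fb n * A - fa n * B) by rewrite ler_peMr ?(ltW b0') //; lia.
  have h2 : fb n <= - (fb n * (fb n.+1 * A - fa n.+1 * B)).
    by rewrite -mulrN ler_peMr ?(ltW b0) //; lia.
  lia.
exists n; rewrite -[s]divq_num_den -/A -/B /slope.
apply/eqP; rewrite eqr_div ?intr_eq0 ?(gt_eqF B0) ?(gt_eqF b0) // -[A%:~R * _]intrM -intrM eqr_int.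
by apply/eqP; move/eqP: D1; rewrite subr_eq0 => /eqP <-; rewrite mulrC.
Qed.

Lemma slope_surj (s : rat) : inS t s -> exists i : int, s = slope i.
Proof.
move=> sS; have [/(slope_surj_ge0 sS)[n ->]|s0] := leP 0 s; first by exists n.
have [||n e] := @slope_surj_ge0 (- s); rewrite ?oppr_ge0 ?ltW //.
  by rewrite /inS denqN.
by exists (- n%:Z); rewrite slopeN -e opprK.
Qed.

Lemma inS_slope (i : int) : inS t (slope i).
Proof. by rewrite /inS denq_slope; case/andP: (fb_bounds i). Qed.

End Farey.

(** * The grid parabola *)

Lemma edge_halfplane (l Q A B x y u v w z : rat) : 0 <= l <= 1 -> 0 < v -> y + l * (Q * A) <= z ->
  w <= v * y - u * x -> w <= v * (y + Q * A) - u * (x + Q * B) ->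
  w <= v * z - u * (x + l * (Q * B)).
Proof.
move=> /andP[l0 l1] v0; rewrite -(ler_pM2l v0) => hz h0 h1.
have l1' : 0 <= 1 - l by rewrite subr_ge0.
have := ler_wpM2l l0 h1; have := ler_wpM2l l1' h0.
lra.
Qed.

(** The choice [M = t./2] treats both parities at once: [(2 * M).+1] is [t] for odd and [t + 1] for
    even [t]. *)
Lemma half_bounds (t : nat) : (2 * t./2 <= t <= (2 * t./2).+1)%N.
Proof. by have := odd_double_half t; lia. Qed.

Section Parabola.

Variable t : nat.
Hypothesis t_gt0 : (0 < t)%N.
Local Notation slope := (slope t).
Local Notation fa := (fa t).
Local Notation fb := (fb t).
Local Notation fc := (fc t).
Local Notation fq := (fq t).
Local Notation fex := (fex t).
Local Notation fey := (fey t).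

Lemma slope_ge0 (i : int) : (0 <= slope i) = (0 <= i).
Proof. by rewrite !leNgt -[X in _ < X](slope0 t) slope_mono. Qed.

Lemma fq_slope (i : int) : fq i = (t %/ den (slope i))%:Z.
Proof.
rewrite /den denq_slope // /fq; have /andP[b0 _] := fb_bounds t_gt0 i.
by rewrite -[in LHS](gtz0_abs b0) divz_nat.
Qed.

Lemma vx_slope (i : int) : vx t (slope i) = (fq i * fb i)%:~R.
Proof.
have /andP[b0 _] := fb_bounds t_gt0 i.
by rewrite /vx -[in RHS](gtz0_abs b0) fq_slope /den denq_slope.
Qed.

Lemma vy_slope (i : int) : vy t (slope i) = (fq i * fa i)%:~R.
Proof. by rewrite /vy numq_slope // -fq_slope. Qed.

Lemma mem_Sbox (K : nat) (s : rat) : inS t s -> `|s| <= K%:R -> s \in Sbox t K.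
Proof.
rewrite /inS => sS sK; rewrite mem_undup.
have d0 := denq_gt0 s.
have nK : `|numq s| <= K%:Z * denq s.
  have dR : 0 < (denq s)%:~R :> rat by rewrite ltr0z.
  have := sK; rewrite -[X in `|X|]divq_num_den normf_div (gtr0_norm dR) ler_pdivrMr //.
  by rewrite -intr_norm -[K%:R]/(K%:~R) -intrM ler_int.
apply/allpairsP; exists (`|denq s|%N, numq s); split.
- by rewrite mem_iota /=; lia.
- have nKt : `|numq s| <= (K * t)%N%:Z by rewrite PoszM; nia.
  apply/mapP; exists `|(numq s + (K * t)%N%:Z)%R|%N; first by rewrite mem_iota; lia.
  by rewrite /=; lia.
- by rewrite /= -[LHS]divq_num_den -[in LHS](gtz0_abs d0) -pmulrn.
Qed.

Lemma sum_Sbox (K : nat) (P : pred rat) (l : seq rat) (F : rat -> rat) : uniq l ->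
  (forall s, (s \in l) = (s \in Sbox t K) && P s) ->
  \sum_(s <- Sbox t K | P s) F s = \sum_(s <- l) F s.
Proof.
move=> ul hl; rewrite -big_filter; apply: perm_big; apply: uniq_perm => //.
  by rewrite filter_uniq // undup_uniq.
by move=> s; rewrite mem_filter hl andbC.
Qed.

Lemma norm_lt_bnd (s : rat) : `|s| <= (bnd s)%:R.
Proof.
have d0 := denq_gt0 s.
have dR : 0 < (denq s)%:~R :> rat by rewrite ltr0z.
rewrite -[X in `|X|]divq_num_den normf_div (gtr0_norm dR) ler_pdivrMr //.
rewrite -intr_norm -[(bnd s)%:R]/((bnd s)%:~R) -intrM ler_int /bnd; nia.
Qed.

Lemma sum_slope_ge0 (n : nat) (F : rat -> rat) :
  \sum_(s <- Sbox t (bnd (slope n)) | inS t s && (0 <= s) && (s < slope n)) F s =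
  \sum_(0 <= j < n) F (slope j%:Z).
Proof.
rewrite (@sum_Sbox _ _ [seq slope j%:Z | j <- iota 0 n]).
- by rewrite big_map /index_iota subn0.
- by rewrite map_inj_uniq ?iota_uniq // => i j /(slope_inj t_gt0) [].
move=> s; apply/mapP/idP => [[j + ->]|/andP[_ /andP[/andP[sS s0] sn]]].
  rewrite mem_iota add0n => jn.
  have lt : slope j < slope n by rewrite slope_mono // ltz_nat.
  have ge0 : 0 <= slope j by rewrite slope_ge0.
  rewrite inS_slope // ge0 lt !andbT; apply: mem_Sbox; first exact: inS_slope.
  rewrite ger0_norm //; apply: le_trans (ltW lt) _.
  by rewrite -{1}[slope n]ger0_norm ?norm_lt_bnd ?slope_ge0.
have [i e] := slope_surj t_gt0 sS; rewrite e slope_ge0 in s0.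
rewrite e slope_mono // in sn.
by exists `|i|%N; rewrite ?mem_iota ?gez0_abs //; lia.
Qed.

Lemma sum_slope_lt0 (n : nat) (F : rat -> rat) :
  \sum_(s <- Sbox t (bnd (slope (- n%:Z))) | inS t s && (slope (- n%:Z) <= s) && (s < 0)) F s =
  \sum_(0 <= j < n) F (slope (- j.+1%:Z)).
Proof.
rewrite (@sum_Sbox _ _ [seq slope (- j.+1%:Z) | j <- iota 0 n]).
- by rewrite big_map /index_iota subn0.
- by rewrite map_inj_uniq ?iota_uniq // => i j /(slope_inj t_gt0) /oppr_inj [].
move=> s; apply/mapP/idP => [[j + ->]|/andP[_ /andP[/andP[sS sn] s0]]].
  rewrite mem_iota add0n => jn.
  have le : slope (- n%:Z) <= slope (- j.+1%:Z) by rewrite leNgt slope_mono //; lia.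
  have lt0 : slope (- j.+1%:Z) < 0 by rewrite ltNge slope_ge0; lia.
  rewrite inS_slope // le lt0 !andbT; apply: mem_Sbox; first exact: inS_slope.
  apply: le_trans (norm_lt_bnd _); rewrite !ltr0_norm ?lerN2 //.
  exact: le_lt_trans lt0.
have [i e] := slope_surj t_gt0 sS; rewrite e ltNge slope_ge0 in s0.
rewrite e leNgt slope_mono // in sn.
exists (`|i|.-1)%N; rewrite ?mem_iota; first by lia.
by rewrite e; congr slope; lia.
Qed.

Lemma start_sum (F : int -> int) (n : nat) :
  \sum_(0 <= j < n) F j.+1%:Z = \sum_(0 <= j < n.+1) F j%:Z - F 0.
Proof. by rewrite big_nat_recl // addrC addKr. Qed.

Lemma sum_intr (n : nat) (F : nat -> int) :
  \sum_(0 <= j < n) (F j)%:~R = (\sum_(0 <= j < n) F j)%:~R :> rat.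
Proof.
elim: n => [|n IH]; first by rewrite !big_geq.
by rewrite !big_nat_recr //= intrD IH.
Qed.

(** Edge [i] starts where edge [i - 1] ends. [startx] counts from the left end of the slope-0 edge
    and [fex] from its right end, which differ by its width [t]. *)
Lemma startx_slope (i : int) : startx t (slope i) = t%:R / 2 + (fex (i - 1))%:~R.
Proof.
have q0 : fq 0 * fb 0 = t%:Z by rewrite /fq /fb /farey /= divz1 mulr1.
rewrite /startx slope_ge0; case: ifPn.
  case: i => // n _; rewrite sum_slope_ge0.
  under eq_bigr do rewrite vx_slope.
  rewrite sum_intr.
  have -> : fex (n%:Z - 1) = \sum_(0 <= j < n) fq j%:Z * fb j%:Z - t%:Z.
    case: n => [|n]; first by rewrite big_geq //= big_nat1 q0 sub0r.
    have -> : n.+1%:Z - 1 = n%:Z by lia.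
    by rewrite /= (start_sum (fun j => fq j * fb j)) q0.
  by rewrite intrB -pmulrn; field.
case: i => // n _; rewrite NegzE sum_slope_lt0.
under eq_bigr do rewrite vx_slope fqN fbN.
rewrite sum_intr.
have -> : - n.+1%:Z - 1 = Negz n.+1 by rewrite NegzE; lia.
by rewrite /= (start_sum (fun j => fq j * fb j)) q0 intrN intrB -pmulrn; field.
Qed.

Lemma starty_slope (i : int) : starty t (slope i) = (fey (i - 1))%:~R.
Proof.
have q0 : fq 0 * fa 0 = 0 by rewrite /fa /farey /= mulr0.
rewrite /starty slope_ge0; case: ifPn.
  case: i => // n _; rewrite sum_slope_ge0.
  under eq_bigr do rewrite vy_slope.
  rewrite sum_intr; congr (_%:~R).
  case: n => [|n]; first by rewrite big_geq //= big_nat1 q0.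
  have -> : n.+1%:Z - 1 = n%:Z by lia.
  by rewrite /= (start_sum (fun j => fq j * fa j)) q0 subr0.
case: i => // n _; rewrite NegzE sum_slope_lt0.
under eq_bigr do rewrite vy_slope fqN faN mulrN.
rewrite sum_intr sumrN intrN opprK.
have -> : - n.+1%:Z - 1 = Negz n.+1 by rewrite NegzE; lia.
by rewrite /= (start_sum (fun j => fq j * fa j)) q0 subr0.
Qed.

(** Each edge lies above line [j] because both its ends do; conversely, the line of the edge over
    column [X] already places the point on or above the chain. *)
Lemma U0_region (p : pt) : U0 t p <-> region fb fa fex fey (t%:R / 2) (fun=> 0) p.
Proof.
have ch := farey_chain t_gt0.
have bal : balanced t./2 fb (fun=> 0) by apply: balanced0; exact: (chain_gt0 ch).
have vX (i : int) : vertx fb fex (fun=> 0) i = fex i by rewrite /vertx /drift !mul0r subrr addr0.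
have vY (i : int) : verty fa fey (fun=> 0) i = fey i by rewrite /verty !mul0r subrr addr0.
have vert (i : int) : above fb fa fex fey (fun=> 0) (fex i) (fey i).
  by have := above_vert ch (half_bounds t) bal i; rewrite vX vY.
split.
  case: p => x y [[X [Y /= [eX eY]]] [y' [[s [sS [l [l01 [e1 e2]]]]] le]]].
  exists X, Y; rewrite eX eY; split=> // j; rewrite addr0 -(ler_int rat).
  have [i es] := slope_surj t_gt0 sS; subst s.
  move: e1 e2; rewrite startx_slope starty_slope vx_slope vy_slope eX => e1 e2.
  have := vert (i - 1) j; have := vert i j; rewrite !addr0 -!(ler_int rat).
  have := chain_ex ch (i - 1); have := chain_ey ch (i - 1); rewrite subrK => -> ->.
  have bj : 0 < (fb j)%:~R :> rat by rewrite ltr0z (chain_gt0 ch).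
  move: e1 e2; move: (fq i) => Q; rewrite /height !(intrB, intrD, intrM) => e1 e2 h1 h0.
  have -> : X%:~R = (fex (i - 1))%:~R + l * (Q%:~R * (fb i)%:~R) :> rat.
    by apply: (addrI (t%:R / 2)); rewrite addrA -e1.
  by apply: edge_halfplane h0 h1 => //; rewrite -e2 -eY.
case=> X [Y [-> hXY]]; split; first by exists X, Y.
have [i] := vert_cover ch (half_bounds t) bal X; rewrite !vX (chain_ex ch) => hX.
have := hXY (i + 1); have := height_vertS ch (fun=> 0) i; rewrite vX vY => <-.
rewrite /height -(ler_int rat) !(intrB, intrM).
have bi : 0 < (fb (i + 1))%:~R :> rat by rewrite ltr0z (chain_gt0 ch).
have L0 : 0 < (fq (i + 1) * fb (i + 1))%:~R :> rat.
  by have := ex_grows ch i 1; rewrite (chain_ex ch) ltr0z; lia.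
set l : rat := (X%:~R - (fex i)%:~R) / (fq (i + 1) * fb (i + 1))%:~R.
have lE : l * (fq (i + 1) * fb (i + 1))%:~R = X%:~R - (fex i)%:~R by rewrite divfK ?gt_eqF.
move=> h; exists ((fey i)%:~R + l * (fq (i + 1) * fa (i + 1))%:~R); split => /=.
  exists (slope (i + 1)); split; first exact: inS_slope.
  exists l; split.
    move: hX; rewrite -!(ler_int rat) intrD => hX.
    by rewrite /l divr_ge0 ?ler_pdivrMr ?mul1r ?(ltW L0) //=; lra.
  by rewrite startx_slope starty_slope vx_slope vy_slope addrK lE; congr pair; ring.
rewrite -(ler_pM2l bi) mulrDr.
have -> : (fb (i + 1))%:~R * (l * (fq (i + 1) * fa (i + 1))%:~R) =
  (fa (i + 1))%:~R * (l * (fq (i + 1) * fb (i + 1))%:~R) by rewrite !intrM; ring.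
by rewrite lE; lra.
Qed.

Lemma Uk_region (k M : nat) (p : pt) : (2 * M <= t <= (2 * M).+1)%N ->
  Uk t k p <-> region fb fa fex fey (t%:R / 2) (level M fb k) p.
Proof.
move=> tM; have ch := farey_chain t_gt0.
have bal j : balanced M fb (level M fb j).
  apply: (@balanced_level _ _ fc); [exact: (chain_gt0 ch)| | |exact: (chain_medb ch)].
    by move=> i; have := chain_le ch i; lia.
  by move=> i; have := chain_adjacent ch i; lia.
elim: k p => [p|k IH p]; first exact: U0_region.
rewrite /Uk iterS; apply: iff_trans (peel_ext IH p) _.
exact: (peel_region _ ch tM).
Qed.

(** Moving a point up by one row adds [fb i] to its height of slope [i], which is the total rise of
    line [i]. *)
Lemma Uk_period (M : nat) (p : pt) : (2 * M <= t <= (2 * M).+1)%N ->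
  Uk t (2 * M).+1 p <-> U0 t (p.1, p.2 - 1).
Proof.
move=> tM; have ch := farey_chain t_gt0.
apply: iff_trans (Uk_region _ _ tM) _; apply: iff_trans (iff_sym (U0_region _)).
have lev i : level M fb (2 * M).+1 i = fb i.
  apply: (@level_period _ _ fc); first exact: (chain_gt0 ch).
  - by move=> j; have := chain_le ch j; lia.
  - by move=> j; have := chain_adjacent ch j; lia.
  - exact: (chain_medb ch).
  - exact: fb_coprime.
split=> [[X [Y [-> h]]]|[X [Y [e h]]]].
  exists X, (Y - 1); split=> [|i]; first by rewrite intrB.
  by have := h i; rewrite lev /height; lia.
exists X, (Y + 1); split=> [|i].
  by case: p e => x y /= [-> e]; rewrite intrD -e subrK.
by have := h i; rewrite lev /height; lia.
Qed.

End Parabola.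

Theorem theorem2 (t : nat) (ht : (1 <= t)%N) :
  (odd t -> forall p : pt, Uk t t p <-> U0 t (p.1, p.2 - 1)) /\
  (~~ odd t -> forall p : pt, Uk t t.+1 p <-> U0 t (p.1, p.2 - 1)).
Proof.
have tE := odd_double_half t.
split=> t_odd p; have := Uk_period ht p (half_bounds t).
  by rewrite (_ : (2 * t./2).+1 = t) //; lia.
by rewrite (_ : (2 * t./2).+1 = t.+1) //; lia.
Qed.
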